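(* Let a convex body $K\subset\mathbb{R}^n$ be covered by a family of planks $P_1,\dots,P_m$ whose normals have only two distinct directions. Then the sum of the widths of the planks $P_1,\dots,P_m$, measured in the norm with unit ball $K-K$, is at least $1$.
   Context: A convex body is a compact convex set with nonempty interior; $K-K=\{x-y:x,y\in K\}$. A plank is a closed region between a pair of parallel hyperplanes; its width in a norm is the distance between these hyperplanes in that norm. The normal of a plank is a nonzero linear functional $n\in(\mathbb{R}^n)^*$, defined up to a nonzero scalar factor, such that the bounding hyperplanes have the form $\{x:\langle n,x\rangle=\mathrm{const}\}$. The condition on directions means that there are two linearly independent functionals $n_1,n_2$ such that the normal of every $P_i$ is proportional to $n_1$ or to $n_2$. *)

(* Defs.v *)
From HB Require Import structures.
From mathcomp Require Import all_boot all_order all_algebra.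
From mathcomp Require Import all_classical all_reals all_analysis.

Set Implicit Arguments.
Unset Strict Implicit.
Unset Printing Implicit Defensive.

Import Order.TTheory GRing.Theory Num.Theory.
Import numFieldNormedType.Exports.

Local Open Scope classical_set_scope.
Local Open Scope ring_scope.

Section Planks.
Context {R : realType} {n : nat}.

Definition convex_body (K : set 'rV[R]_n) : Prop :=
  [/\ compact K, convex_set K & interior K !=set0].

Definition difference_body (K : set 'rV[R]_n) : set 'rV[R]_n :=
  [set x - y | x in K & y in K].

(* When [B] is the unit ball of a norm, [gauge B] is that norm (the set below
   is nonempty and bounded from below by 0, so that [inf] is the infimum). *)
Definition gauge (B : set 'rV[R]_n) (v : 'rV[R]_n) : R :=
  inf [set t | 0 < t /\ exists2 w, B w & v = t *: w].

Definition set_distance (N : 'rV[R]_n -> R) (A B : set 'rV[R]_n) : R :=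
  inf [set N (x - y) | x in A & y in B].

(* ['Hom('rV[R]_n, R^o)] is the dual space, with its vector space structure. *)
Definition hyperplane (f : 'Hom('rV[R]_n, R^o)) (c : R) : set 'rV[R]_n :=
  [set x | f x = c].

(* The bounding hyperplanes are allowed to coincide. *)
Record plank := Plank {
  normal : 'Hom('rV[R]_n, R^o);
  lo : R;
  hi : R;
  normal_neq0 : normal != 0;
  lo_le_hi : lo <= hi
}.

Definition plank_set (P : plank) : set 'rV[R]_n :=
  [set x | lo P <= normal P x <= hi P].

Definition width (N : 'rV[R]_n -> R) (P : plank) : R :=
  set_distance N (hyperplane (normal P) (lo P)) (hyperplane (normal P) (hi P)).

Definition proportional (f g : 'Hom('rV[R]_n, R^o)) : Prop :=
  exists c : R, f = c *: g.

End Planks.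

Arguments plank : clear implicits.

(* Main.v *)
Require Import Defs.
From HB Require Import structures.
From mathcomp Require Import all_boot all_order all_algebra.
From mathcomp Require Import all_classical all_reals all_analysis.
From mathcomp Require Import ring lra.

(** Only the two normals matter, so [K] is looked at through the pair
    (n1, n2), rescaled so that each of them runs exactly over [0, 1] on [K].
    The width of a plank in the norm of [K - K] then becomes at least the
    Euclidean width of the horizontal or vertical strip that it turns into
    ([plank_strip]), and the image of [K] contains a quadrilateral with
    vertices on the four sides of the unit square:
    L = (0, p), B = (r, 0), R = (1, q), T = (s, 1).  It remains to see that
    strips covering this quadrilateral have total width at least 1.

    The reason is that the quadrilateral carries a probability measure mu both
    of whose marginals are the uniform measure on [0, 1].  The mu-measure of a
    vertical or horizontal strip is then at most its width, and strips covering
    the support of mu have total mu-measure at least 1.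

    The measure mu is explicit: it is a sum of multiples of the uniform
    measures on the four edges LB, LT, RB, RT and on one diagonal.  With the
    diagonal BT, the edges LB and LT receive masses p b and (1 - p) b, and the
    edges RB and RT receive q b' and (1 - q) b'; the vertical marginal is then
    uniform as soon as the total mass is 1.  Uniformity of the horizontal
    marginal forces
      b = r s / (p s + (1 - p) r),
      b' = (1 - r) (1 - s) / (q (1 - s) + (1 - q) (1 - r)),
    and the mass left for BT has the sign of (s - r) D, where
      D = p s (1 - q) (1 - r) - q r (1 - s) (1 - p).
    Exchanging the two coordinates gives the solution that uses the diagonal
    LR, whose mass has the sign of (p - q) D.  One of these two signs is always
    nonnegative ([diagonal_sign]), so one of the two measures exists.

    The formulas for b and b' need nonzero denominators, which is ensured by
    moving the vertices slightly towards the midpoints of the sides of the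
    square and thickening the strips accordingly ([quadrilateral_strips]).  No
    measure on the plane appears in the proofs: the mass that the uniform
    measure on a segment gives to a strip is the number [share], and covering a
    segment gives [segment_share]. *)

Set Implicit Arguments.
Unset Strict Implicit.
Unset Printing Implicit Defensive.

Import Order.TTheory GRing.Theory Num.Theory.
Import numFieldNormedType.Exports.

Local Open Scope classical_set_scope.
Local Open Scope ring_scope.

(** * Covering a segment by strips *)

Lemma interval_cover_length (R : realType) (m : nat) (a b : 'I_m -> R) :
  (forall i, a i <= b i) ->
  (forall t, 0 <= t <= 1 -> exists i, a i <= t <= b i) ->
  1 <= \sum_i (b i - a i).
Proof.
move=> ab cov.
(* The subadditivity lemma used below concerns families indexed by [nat]. *)
pose A (k : nat) := if insub k is Some i then [set` `[a i, b i]] else set0.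
have mA k : measurable (A k : set (measurableTypeR R)).
  by rewrite /A; case: insubP => [i _ _|_]; [exact: measurable_itv|exact: measurable0].
have sub : [set` (`[0%R, 1%R] : interval R)] `<=` \big[setU/set0]_(k < m) A k.
  move=> t; rewrite /= in_itv /= => /cov[i ti].
  by rewrite -bigcup_mkord; exists i => //=; rewrite /A valK /= in_itv.
have : (lebesgue_measure [set` (`[0%R, 1%R] : interval R)] <=
        \sum_(k < m) lebesgue_measure (A k))%E.
  apply: content_subadditive => [k _| |]; [exact: mA|exact: measurable_itv|exact: sub].
rewrite lebesgue_measure_itv /= lte_fin ltr01 oppr0 adde0.
rewrite (eq_bigr (fun i : 'I_m => (b i - a i)%:E)) => [|i _].
  by rewrite sumEFin lee_fin.
rewrite /A valK lebesgue_measure_itv /= lte_fin; case: ltP => // ba.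
by rewrite (le_anti (introT andP (conj ba (ab i)))) subrr.
Qed.

Section Clip.
Context {R : realFieldType}.
Implicit Types lo hi x t : R.

(** The nearest point of [[lo, hi]].  For [x0 <= x1], the difference
    [clip lo hi x1 - clip lo hi x0] is the length of the part of [[lo, hi]]
    that lies between [x0] and [x1]; unlike this length, it is additive in the
    pair of endpoints. *)
Definition clip lo hi x : R := Num.max lo (Num.min x hi).

Lemma clip_id lo hi x : lo <= x <= hi -> clip lo hi x = x.
Proof. by case/andP => lx xh; rewrite /clip (min_idPl xh) (max_idPr lx). Qed.

Lemma clip_homo lo hi (x y : R) :
  x <= y -> clip lo hi x <= clip lo hi y.
Proof.
move=> xy.
by rewrite /clip ge_max le_max lexx /= le_max le_min !ge_min xy lexx !orbT.
Qed.

Lemma clip_itv lo hi x :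
  lo <= hi -> lo <= clip lo hi x <= hi.
Proof. by move=> lh; rewrite /clip le_max lexx ge_max lh ge_min lexx orbT. Qed.

(** For a point moving uniformly from [x0] to [x1], the fraction of time spent
    in [[lo, hi]]. *)
Definition rel_share lo hi x0 x1 : R :=
  (clip lo hi x1 - clip lo hi x0) / (x1 - x0).

(** The times at which the moving point is in [[lo, hi]] lie in an interval of
    length [rel_share lo hi x0 x1].  Its ends may fall outside [[0, 1]], when
    the path misses [[lo, hi]]; both signs of [x1 - x0] occur. *)
Lemma clip_param lo hi x0 x1 t :
  x0 != x1 -> 0 <= t <= 1 -> lo <= x0 + t * (x1 - x0) <= hi ->
  (clip lo hi x0 - x0) / (x1 - x0) <= t <= (clip lo hi x1 - x0) / (x1 - x0).
Proof.
move=> x01 /andP[t0 t1] z.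
have zE := clip_id z.
have [lt01|lt10] : x0 < x1 \/ x1 < x0 by apply/orP; rewrite -neq_lt.
  have d0 : 0 < x1 - x0 by lra.
  have z0 : x0 <= x0 + t * (x1 - x0) by nra.
  have z1 : x0 + t * (x1 - x0) <= x1 by nra.
  have := clip_homo lo hi z0; have := clip_homo lo hi z1.
  rewrite zE ler_pdivlMr // ler_pdivrMr // => ? ?; apply/andP; split; lra.
have d0 : x1 - x0 < 0 by lra.
have z0 : x0 + t * (x1 - x0) <= x0 by nra.
have z1 : x1 <= x0 + t * (x1 - x0) by nra.
have := clip_homo lo hi z0; have := clip_homo lo hi z1.
rewrite zE ler_ndivlMr // ler_ndivrMr // => ? ?; apply/andP; split; lra.
Qed.

Lemma rel_share_ge0 lo hi x0 x1 :
  0 <= rel_share lo hi x0 x1.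
Proof.
rewrite /rel_share; have [le01|/ltW le10] := leP x0 x1.
  by apply: divr_ge0; rewrite subr_ge0 ?clip_homo.
by rewrite -mulrNN -invrN !opprB; apply: divr_ge0; rewrite subr_ge0 ?clip_homo.
Qed.

End Clip.

Section Strips.
Context {R : realType} {m : nat}.
Implicit Types (v : 'I_m -> bool) (lo hi : 'I_m -> R).

(** The [i]-th strip bounds the first coordinate if [v i], the second one
    otherwise. *)
Definition strip_covered v lo hi (x y : R) :=
  exists i, lo i <= (if v i then x else y) <= hi i.

Definition segment_covered v lo hi (x0 y0 x1 y1 : R) :=
  forall t, 0 <= t <= 1 ->
    strip_covered v lo hi (x0 + t * (x1 - x0)) (y0 + t * (y1 - y0)).

(** The fraction of the segment from [(x0, y0)] to [(x1, y1)] that lies in the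
    [i]-th strip. *)
Definition share v lo hi (x0 y0 x1 y1 : R) (i : 'I_m) : R :=
  if v i then rel_share (lo i) (hi i) x0 x1
  else rel_share (lo i) (hi i) y0 y1.

(** Pulled back to the parameter of the segment, the strips become intervals
    that cover [[0, 1]].  The coordinates must both vary, because a constant
    coordinate turns a strip into all or nothing. *)
Lemma segment_share v lo hi (x0 y0 x1 y1 : R) :
  x0 != x1 -> y0 != y1 -> segment_covered v lo hi x0 y0 x1 y1 ->
  1 <= \sum_i share v lo hi x0 y0 x1 y1 i.
Proof.
move=> x01 y01 cov.
pose u0 i := if v i then x0 else y0.
pose u1 i := if v i then x1 else y1.
pose a i := (clip (lo i) (hi i) (u0 i) - u0 i) / (u1 i - u0 i).
pose b i := (clip (lo i) (hi i) (u1 i) - u0 i) / (u1 i - u0 i).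
have sE i : share v lo hi x0 y0 x1 y1 i = b i - a i.
  by rewrite /share /b /a /u0 /u1 /rel_share; case: (v i); ring.
rewrite (eq_bigr _ (fun i _ => sE i)); apply: interval_cover_length.
  move=> i; rewrite -subr_ge0 -sE /share.
  by case: (v i); exact: rel_share_ge0.
move=> t t01; have [i Hi] := cov t t01; exists i; move: Hi.
rewrite /a /b /u0 /u1; case: (v i) => Hi; exact: clip_param.
Qed.

(** * Covering an inscribed quadrilateral by strips *)

(** The vertices, with weights [a], [b], [c], [d], are [(0, p)], [(r, 0)],
    [(1, q)] and [(s, 1)]. *)
Definition quadrilateral_covered v lo hi (p q r s : R) :=
  forall a b c d, 0 <= a -> 0 <= b -> 0 <= c -> 0 <= d -> a + b + c + d = 1 ->
    strip_covered v lo hi (b * r + c + d * s) (a * p + c * q + d).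

(** The measure on the four edges and the diagonal BT has nonnegative weights
    under the sign condition of this lemma.  Each of the five segments is
    covered, so averaging their shares with these weights gives at least 1,
    while the average share of a single strip is at most its width. *)
Lemma quadrilateral_diagonal_strips v lo hi (p q r s : R) :
  (forall i, lo i <= hi i) ->
  0 < p < 1 -> 0 < q < 1 -> 0 < r < 1 -> 0 < s < 1 ->
  0 <= (s - r) * (p * s * (1 - q) * (1 - r) - q * r * (1 - s) * (1 - p)) ->
  quadrilateral_covered v lo hi p q r s ->
  1 <= \sum_i (hi i - lo i).
Proof.
move=> lohi /andP[p0 p1] /andP[q0 q1] /andP[r0 r1] /andP[s0 s1] D0 cov.
have hull a b c d x y : 0 <= a -> 0 <= b -> 0 <= c -> 0 <= d ->
    a + b + c + d = 1 -> b * r + c + d * s = x -> a * p + c * q + d = y ->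
    strip_covered v lo hi x y.
  by move=> a0 b0 c0 d0 e <- <-; exact: cov.
have cLB : segment_covered v lo hi 0 p r 0.
  by move=> t /andP[t0 t1]; apply: (hull (1 - t) t 0 0); lra.
have cLT : segment_covered v lo hi 0 p s 1.
  by move=> t /andP[t0 t1]; apply: (hull (1 - t) 0 0 t); lra.
have cRB : segment_covered v lo hi 1 q r 0.
  by move=> t /andP[t0 t1]; apply: (hull 0 t (1 - t) 0); lra.
have cRT : segment_covered v lo hi 1 q s 1.
  by move=> t /andP[t0 t1]; apply: (hull 0 0 (1 - t) t); lra.
have cBT : segment_covered v lo hi r 0 s 1.
  by move=> t /andP[t0 t1]; apply: (hull 0 (1 - t) 0 t); lra.
have [p1' q1' r1' s1'] : [/\ 0 < 1 - p, 0 < 1 - q, 0 < 1 - r & 0 < 1 - s].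
  by split; lra.
have [p1n q1n r1n s1n] : [/\ p - 1 != 0, q - 1 != 0, r - 1 != 0 & s - 1 != 0].
  by split; rewrite subr_eq0 lt_eqF.
pose P := p * s + (1 - p) * r.
pose Q := q * (1 - s) + (1 - q) * (1 - r).
have P0 : 0 < P by rewrite /P addr_gt0 // mulr_gt0.
have Q0 : 0 < Q by rewrite /Q addr_gt0 // mulr_gt0.
(* The masses of LB, LT, RB, RT and BT are [p * b], [(1 - p) * b], [q * b'],
   [(1 - q) * b'] and [w]. *)
pose b := r * s / P; pose b' := (1 - r) * (1 - s) / Q.
have b0 : 0 <= b by rewrite /b divr_ge0 ?mulr_ge0 //; lra.
have b'0 : 0 <= b' by rewrite /b' divr_ge0 ?mulr_ge0 //; lra.
pose w := (s - r) * (p * s / P - q * (1 - s) / Q).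
have wE : w = (s - r) *
    (p * s * (1 - q) * (1 - r) - q * r * (1 - s) * (1 - p)) / (P * Q).
  by rewrite /w /P /Q; field; rewrite -/P -/Q !gt_eqF.
have w0 : 0 <= w by rewrite wE divr_ge0 // mulr_ge0 // ltW.
have Pn : P != 0 by rewrite gt_eqF.
have Qn : Q != 0 by rewrite gt_eqF.
have total : p * b + (1 - p) * b + q * b' + (1 - q) * b' + w = 1.
  by rewrite /b /b' /w /P /Q; field; rewrite -/P -/Q Pn Qn.
set S := segment_covered v lo hi in cLB cLT cRB cRT cBT.
pose h := share v lo hi.
have weigh c x0 y0 x1 y1 : 0 <= c -> x0 != x1 -> y0 != y1 -> S x0 y0 x1 y1 ->
    c <= \sum_i c * h x0 y0 x1 y1 i.
  move=> c0 x01 y01 seg; rewrite -mulr_sumr -{1}[c]mulr1 ler_wpM2l //.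
  exact: segment_share.
(* For [r = s] the diagonal is vertical and [segment_share] does not apply to
   it, but its mass is then zero. *)
have wBT : w <= \sum_i w * h r 0 s 1 i.
  have [rs|rs] := eqVneq r s.
    have -> : w = 0 by rewrite /w rs subrr mul0r.
    by rewrite big1 // => i _; rewrite mul0r.
  by apply: weigh => //; rewrite eq_sym oner_eq0.
have wLB : p * b <= \sum_i p * b * h 0 p r 0 i.
  by apply: weigh => //; [rewrite mulr_ge0 // ltW|rewrite lt_eqF|rewrite gt_eqF].
have wLT : (1 - p) * b <= \sum_i (1 - p) * b * h 0 p s 1 i.
  by apply: weigh => //; [rewrite mulr_ge0 // ltW|rewrite lt_eqF|rewrite lt_eqF].
have wRB : q * b' <= \sum_i q * b' * h 1 q r 0 i.
  by apply: weigh => //; [rewrite mulr_ge0 // ltW|rewrite gt_eqF|rewrite gt_eqF].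
have wRT : (1 - q) * b' <= \sum_i (1 - q) * b' * h 1 q s 1 i.
  by apply: weigh => //; [rewrite mulr_ge0 // ltW|rewrite gt_eqF|rewrite lt_eqF].
have neqs := (Pn, Qn, lt0r_neq0 p0, lt0r_neq0 q0, lt0r_neq0 r0, lt0r_neq0 s0,
  lt0r_neq0 p1', lt0r_neq0 q1', lt0r_neq0 r1', lt0r_neq0 s1', p1n, q1n, r1n, s1n).
(* The marginals are uniform.  For a vertical strip, the coefficients of
   [clip _ _ r] and of [clip _ _ s] on the left-hand side vanish; for a
   horizontal one, those of [clip _ _ p] and of [clip _ _ q] do. *)
have key i : p * b * h 0 p r 0 i + (1 - p) * b * h 0 p s 1 i
    + q * b' * h 1 q r 0 i + (1 - q) * b' * h 1 q s 1 i + w * h r 0 s 1 i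
    <= hi i - lo i.
  have c0 := clip_itv 0 (lohi i); have c1 := clip_itv 1 (lohi i).
  rewrite /h /share; case: (v i); rewrite /rel_share.
    set F0 := clip _ _ 0 in c0 *; set F1 := clip _ _ 1 in c1 *.
    set Fr := clip _ _ r; set Fs := clip _ _ s.
    have -> : w * ((Fs - Fr) / (s - r)) =
        (p * s / P - q * (1 - s) / Q) * (Fs - Fr).
      rewrite /w; have [rs|rs] := eqVneq r s.
        by rewrite /Fs /Fr rs !subrr !(mulr0, mul0r).
      by field; rewrite Pn Qn subr_eq0 eq_sym.
    set lhs := (X in X <= _); have -> : lhs = F1 - F0; last by lra.
    by rewrite /lhs /b /b' /P /Q; field; rewrite -/P -/Q !neqs.
  set F0 := clip _ _ 0 in c0 *; set F1 := clip _ _ 1 in c1 *.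
  set Fp := clip _ _ p; set Fq := clip _ _ q.
  set lhs := (X in X <= _); have -> : lhs = F1 - F0; last by lra.
  by rewrite /lhs /b /b' /w /P /Q; field; rewrite -/P -/Q !neqs.
have : \sum_i (p * b * h 0 p r 0 i + (1 - p) * b * h 0 p s 1 i
    + q * b' * h 1 q r 0 i + (1 - q) * b' * h 1 q s 1 i + w * h r 0 s 1 i)
    <= \sum_i (hi i - lo i) by apply: ler_sum => i _; exact: key.
rewrite !big_split /=; lra.
Qed.

(** With A = p (1 - q), A' = q (1 - p), B = s (1 - r) and B' = r (1 - s), the
    factor common to both products is A B - A' B', where A - A' = p - q and
    B - B' = s - r.  If p - q and s - r have the same sign, this factor has that
    sign too; otherwise one of them agrees in sign with the factor, whatever it
    is. *)
Lemma diagonal_sign (p q r s : R) :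
  0 < p < 1 -> 0 < q < 1 -> 0 < r < 1 -> 0 < s < 1 ->
  let D := p * s * (1 - q) * (1 - r) - q * r * (1 - s) * (1 - p) in
  0 <= (s - r) * D \/ 0 <= (p - q) * D.
Proof.
move=> /andP[p0 p1] /andP[q0 q1] /andP[r0 r1] /andP[s0 s1] D.
have DE : D = p * (1 - q) * (s * (1 - r)) - q * (1 - p) * (r * (1 - s)).
  by rewrite /D; ring.
have A0 : 0 <= p * (1 - q) by apply: mulr_ge0; lra.
have A'0 : 0 <= q * (1 - p) by apply: mulr_ge0; lra.
have B0 : 0 <= s * (1 - r) by apply: mulr_ge0; lra.
have B'0 : 0 <= r * (1 - s) by apply: mulr_ge0; lra.
have [rs|sr] := leP r s; have [qp|pq] := leP q p.
- left; apply: mulr_ge0; first by rewrite subr_ge0.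
  by rewrite DE subr_ge0; apply: ler_pM => //; lra.
- have [D0|D0] := leP 0 D; first by left; apply: mulr_ge0; rewrite // subr_ge0.
  by right; apply: mulr_le0; [rewrite subr_le0 ltW|exact: ltW].
- have [D0|D0] := leP 0 D; first by right; apply: mulr_ge0; rewrite // subr_ge0.
  by left; apply: mulr_le0; [rewrite subr_le0 ltW|exact: ltW].
- left; apply: mulr_le0; first by rewrite subr_le0 ltW.
  by rewrite DE subr_le0; apply: ler_pM => //; lra.
Qed.

Lemma interior_quadrilateral_strips v lo hi (p q r s : R) :
  (forall i, lo i <= hi i) ->
  0 < p < 1 -> 0 < q < 1 -> 0 < r < 1 -> 0 < s < 1 ->
  quadrilateral_covered v lo hi p q r s ->
  1 <= \sum_i (hi i - lo i).
Proof.
move=> lohi p01 q01 r01 s01 cov.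
have [BT|LR] := diagonal_sign p01 q01 r01 s01.
  exact: (quadrilateral_diagonal_strips lohi p01 q01 r01 s01 BT cov).
(* Reflection in the line x = y exchanges L with B and R with T, and thus turns
   the diagonal LR into the diagonal BT. *)
have covT : quadrilateral_covered (fun i => ~~ v i) lo hi r s p q.
  move=> a b c d a0 b0 c0 d0 abcd.
  have bacd : b + a + d + c = 1 by lra.
  have [i Hi] := cov b a d c b0 a0 d0 c0 bacd.
  exists i; move: Hi; rewrite if_neg; case: (v i).
    by rewrite [a * r + d + _]addrAC.
  by rewrite [b * p + d * q + _]addrAC.
apply: (quadrilateral_diagonal_strips lohi r01 s01 p01 q01 _ covT).
suff -> : r * q * (1 - s) * (1 - p) - s * p * (1 - q) * (1 - r) =
    - (p * s * (1 - q) * (1 - r) - q * r * (1 - s) * (1 - p)).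
  by rewrite mulrN -mulNr opprB.
ring.
Qed.

(** Vertices at corners of the square are allowed here, where the weights of the
    measure could be undefined.  Contracting [p], [q], [r], [s] towards 1 / 2
    and thickening the strips costs an arbitrarily small total width. *)
Lemma quadrilateral_strips v lo hi (p q r s : R) :
  (forall i, lo i <= hi i) ->
  0 <= p <= 1 -> 0 <= q <= 1 -> 0 <= r <= 1 -> 0 <= s <= 1 ->
  quadrilateral_covered v lo hi p q r s ->
  1 <= \sum_i (hi i - lo i).
Proof.
move=> lohi p01 q01 r01 s01 cov; apply/ler_addgt0Pr => e e0.
pose eta : R := Num.min (1 / 2) (e / (m.+1)%:R).
have m0 : 0 < (m.+1)%:R :> R by rewrite ltr0n.
have eta0 : 0 < eta by rewrite lt_min divr_gt0 //= divr_gt0.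
have eta1 : eta < 1 by rewrite gt_min; apply/orP; left; lra.
have etae : m%:R * eta <= e.
  have : eta <= e / (m.+1)%:R by rewrite ge_min lexx orbT.
  rewrite ler_pdivlMr // -natr1 => h; lra.
pose shrink (x : R) := x + eta * (1 / 2 - x).
have shrink01 x : 0 <= x <= 1 -> 0 < shrink x < 1.
  by move=> /andP[x0 x1]; rewrite /shrink; apply/andP; split; nra.
have := @interior_quadrilateral_strips v (fun i => lo i - eta / 2)
  (fun i => hi i + eta / 2) (shrink p) (shrink q) (shrink r) (shrink s).
have -> : \sum_i (hi i + eta / 2 - (lo i - eta / 2)) =
    \sum_i (hi i - lo i) + m%:R * eta.
  rewrite (eq_bigr (fun i => hi i - lo i + eta)) => [|i _]; last by field.
  by rewrite big_split /= sumr_const card_ord mulr_natl.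
move=> /(_ _ (shrink01 _ p01) (shrink01 _ q01) (shrink01 _ r01) (shrink01 _ s01)).
move=> main; apply: le_trans (main _ _) _; last by lra.
  by move=> i; have := lohi i; lra.
move=> a b c d a0 b0 c0 d0 abcd; have [i Hi] := cov a b c d a0 b0 c0 d0 abcd.
(* Contracting by [shrink] moves each convex combination of the vertices by at
   most [eta / 2] in both coordinates; [k] and [l] are the weights of the two
   vertices for which the coordinate in question changes. *)
have close k l x y : 0 <= k -> 0 <= l -> k + l <= 1 ->
    0 <= x <= 1 -> 0 <= y <= 1 ->
    - (eta / 2) <= eta * (k * (1 / 2 - x) + l * (1 / 2 - y)) <= eta / 2.
  move=> k0 l0 kl /andP[x0 x1] /andP[y0 y1].
  have k1 : - k / 2 <= k * (1 / 2 - x) <= k / 2 by apply/andP; split; nra.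
  have l1 : - l / 2 <= l * (1 / 2 - y) <= l / 2 by apply/andP; split; nra.
  by apply/andP; split; nra.
have cx := close b d r s b0 d0 (ltac:(lra)) r01 s01.
have cy := close a c p q a0 c0 (ltac:(lra)) p01 q01.
exists i; move: Hi; rewrite /shrink; case: (v i) => /andP[h1 h2];
  apply/andP; split; lra.
Qed.

End Strips.

(** * Convex bodies and linear forms *)

Section ConvexBodies.
Context {R : realType} {n : nat}.
Implicit Types (K : set 'rV[R]_n) (f g : 'Hom('rV[R]_n, R^o)).

(** Scaling by [a + b] instead of dividing by it lets this lemma be iterated
    without excluding zero weights. *)
Lemma convex_scaled_add K (a b : R) (x y : 'rV[R]_n) :
  convex_set K -> K x -> K y -> 0 <= a -> 0 <= b ->
  exists2 z, K z & a *: x + b *: y = (a + b) *: z.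
Proof.
move=> cK Kx Ky a0 b0; have [ab0|abn] := eqVneq (a + b) 0.
  have /andP[/eqP -> /eqP ->] : (a == 0) && (b == 0) by rewrite -paddr_eq0 // ab0.
  by exists x => //; rewrite addr0 !scale0r addr0.
have ab_gt0 : 0 < a + b by rewrite lt0r abn addr_ge0.
have t0 : 0 <= a / (a + b) by rewrite divr_ge0 // ltW.
have t1 : a / (a + b) <= 1 by rewrite ler_pdivrMr // mul1r lerDl.
have := cK x y (Itv01 t0 t1) (mem_set Kx) (mem_set Ky).
set z := conv _ _ _ => /set_mem Kz; exists z => //.
rewrite /z /conv /= scalerDr !scalerA mulrCA divff // mulr1 /unstable.onem.
by congr (_ + _ *: _); field.
Qed.

Lemma convex_comb4 K (a b c d : R) (x y z t : 'rV[R]_n) :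
  convex_set K -> K x -> K y -> K z -> K t ->
  0 <= a -> 0 <= b -> 0 <= c -> 0 <= d -> a + b + c + d = 1 ->
  K (a *: x + b *: y + c *: z + d *: t).
Proof.
move=> cK Kx Ky Kz Kt a0 b0 c0 d0 e.
have [u Ku ->] := convex_scaled_add cK Kx Ky a0 b0.
have [v Kv ->] := convex_scaled_add cK Ku Kz (addr_ge0 a0 b0) c0.
have abc0 : 0 <= a + b + c by rewrite !addr_ge0.
have [w Kw ->] := convex_scaled_add cK Kv Kt abc0 d0.
by rewrite e scale1r.
Qed.

Lemma linear_form_continuous f : continuous (f : 'rV[R]_n -> R).
Proof.
have -> : (f : 'rV[R]_n -> R) = (fun x => \sum_j x 0 j * f (delta_mx 0 j)).
  apply/funext => x; rewrite {1}(row_sum_delta x) linear_sum /=.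
  by apply: eq_bigr => j _; rewrite linearZ.
apply: continuous_big => [|j _ x]; first exact: add_continuous.
by apply: (@cvgMr_tmp _ _ (nbhs (x : 'rV[R]_n))); exact: coord_continuous.
Qed.

Lemma linear_form_extrema K f :
  compact K -> K !=set0 ->
  exists2 xy : 'rV[R]_n * 'rV[R]_n, K xy.1 /\ K xy.2 &
    forall k, K k -> f xy.1 <= f k <= f xy.2.
Proof.
move=> cK K0.
have cf : {within K, continuous (f : 'rV[R]_n -> R)}.
  exact: continuous_subspaceT (@linear_form_continuous f).
have [x /set_mem Kx xmin] := EVT_min_rV K0 cK cf.
have [y /set_mem Ky ymax] := EVT_max_rV K0 cK cf.
exists (x, y) => // k Kk.
by apply/andP; split; [exact/xmin/mem_set|exact/ymax/mem_set].
Qed.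

Lemma interior_step K (z v : 'rV[R]_n) :
  interior K z -> exists2 t : R, 0 < t & K (z + t *: v).
Proof.
move=> Kz.
have cv : (z + t *: v) @[t --> (0 : R)] --> z.
  have : (z + t *: v) @[t --> (0 : R)] --> z + 0 *: v.
    by apply: cvgD; [exact: cvg_cst|apply: cvgZr_tmp; exact: cvg_id].
  by rewrite scale0r addr0.
have : \forall t \near (0 : R), K (z + t *: v) by apply: cv.
move=> /nbhs_ballP[e /= e0 he]; exists (e / 2); first by rewrite divr_gt0.
apply: he; rewrite /ball /= sub0r normrN gtr0_norm ?divr_gt0 //.
by rewrite ltr_pdivrMr // mulr_natr mulr2n ltrDl.
Qed.

(** If [v = t *: (x - y)] with [x], [y] in [K] and [t > 0], then
    [f v <= t * W].  The interior of [K] ensures that such [t] exist, as the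
    infimum of an empty set would be 0. *)
Lemma gauge_ge K f (W : R) (v : 'rV[R]_n) :
  interior K !=set0 -> 0 < W -> (forall x y, K x -> K y -> f x - f y <= W) ->
  f v / W <= gauge (difference_body K) v.
Proof.
move=> [z Kz] W0 fW; apply: lb_le_inf.
  have [t t0 Kzt] := interior_step v Kz.
  exists t^-1; split; first by rewrite invr_gt0.
  exists (t *: v); last by rewrite scalerA mulVf ?scale1r ?gt_eqF.
  exists (z + t *: v) => //; exists z; first exact: interior_subset.
  by rewrite addrC addKr.
move=> t [t0 [w [x Kx [y Ky <-]] ->]].
by rewrite linearZ /= linearB /= ler_pdivrMr // ler_pM2l // fW.
Qed.

(** The oscillation of the normal on [K] is its maximum on [K - K], so a vector
    that leads from one bounding hyperplane to the other must have
    norm at least [(hi P - lo P) / W].  Both hyperplanes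
    are nonempty because the normal is nonzero. *)
Lemma width_ge K (P : plank R n) (W : R) :
  interior K !=set0 -> 0 < W ->
  (forall x y, K x -> K y -> normal P x - normal P y <= W) ->
  (hi P - lo P) / W <= width (gauge (difference_body K)) P.
Proof.
move=> K0 W0 fW; apply: lb_le_inf.
  have [v fv] : exists v, normal P v != 0.
    apply: contrapT => nf; have /negP := normal_neq0 P; apply.
    apply/eqP/lfunP => v; rewrite zero_lfunE; apply: contrapT => fv.
    by apply: nf; exists v; apply/eqP.
  have on c : hyperplane (normal P) c ((c / normal P v) *: v).
    rewrite /hyperplane /=.
    have -> : normal P ((c / normal P v) *: v) = c / normal P v * normal P v.
      exact: linearZ.
    by rewrite divfK.
  by eexists; exists ((lo P / normal P v) *: v) => //;
     exists ((hi P / normal P v) *: v) => //.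
move=> _ [x xlo [y yhi <-]].
(* [normal P (x - y)] is [lo P - hi P <= 0], so that the form which bounds the
   gauge of [x - y] from below is [- normal P]. *)
have Wneg a b : K a -> K b -> (- normal P) a - (- normal P) b <= W.
  by move=> Ka Kb; rewrite !opp_lfunE opprK addrC fW.
have := gauge_ge (x - y) K0 W0 Wneg.
by rewrite opp_lfunE linearB /= xlo yhi opprB.
Qed.

Lemma oscillation_gt0 K f (W : R) :
  interior K !=set0 -> f != 0 -> (forall x y, K x -> K y -> f x - f y <= W) ->
  0 < W.
Proof.
move=> [z Kz] f0 fW.
have [v fv] : exists v, 0 < f v.
  apply: contrapT => nf; have /negP := f0; apply.
  apply/eqP/lfunP => v; rewrite zero_lfunE.
  have le0 w : f w <= 0 by rewrite leNgt; apply/negP => fw; apply: nf; exists w.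
  by apply: le_anti; rewrite le0 /= -oppr_le0 -linearN le0.
have [t t0 Kt] := interior_step v Kz.
apply: lt_le_trans (fW _ _ Kt (interior_subset Kz)).
by rewrite linearD /= linearZ /= addrC addKr mulr_gt0.
Qed.

(** In the rescaled coordinate [(g k - l) / W], the plank becomes an interval
    whose length is at most the width of the plank.  If the normal is a negative
    multiple of [g], the two bounds exchange their roles. *)
Lemma plank_strip K (P : plank R n) (g : 'Hom('rV[R]_n, R^o)) (l W : R) :
  interior K !=set0 -> 0 < W -> (forall x y, K x -> K y -> g x - g y <= W) ->
  proportional (normal P) g ->
  exists ab : R * R, [/\ ab.1 <= ab.2,
    ab.2 - ab.1 <= width (gauge (difference_body K)) P &
    forall k, plank_set P k -> ab.1 <= (g k - l) / W <= ab.2].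
Proof.
move=> K0 W0 gW [c Pc].
have c0 : c != 0.
  by apply/eqP => c0; move: (normal_neq0 P); rewrite Pc c0 scale0r eqxx.
have fE k : normal P k = c * g k by rewrite Pc scale_lfunE.
have lh := lo_le_hi P.
have [cn|cp] : c < 0 \/ 0 < c by apply/orP; rewrite -neq_lt.
- have W'0 : 0 < - c * W by rewrite mulr_gt0 // oppr_gt0.
  have fW x y : K x -> K y -> normal P x - normal P y <= - c * W.
    by move=> Kx Ky; rewrite !fE; have := gW _ _ Ky Kx; nra.
  have wid := width_ge K0 W'0 fW.
  exists ((hi P / c - l) / W, (lo P / c - l) / W); split => /=.
  + by rewrite ler_pM2r ?invr_gt0 // lerD2r ler_nM2r // invr_lt0.
  + apply: le_trans wid; rewrite le_eqVlt; apply/orP; left; apply/eqP.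
    by field; rewrite c0 gt_eqF.
  + move=> k; rewrite /plank_set /= fE => /andP[kl kh].
    rewrite !ler_pM2r ?invr_gt0 // !lerD2r ler_ndivrMr // ler_ndivlMr //.
    by rewrite ![g k * c]mulrC kl kh.
- have W'0 : 0 < c * W by rewrite mulr_gt0.
  have fW x y : K x -> K y -> normal P x - normal P y <= c * W.
    by move=> Kx Ky; rewrite !fE -mulrBr ler_pM2l // gW.
  have wid := width_ge K0 W'0 fW.
  exists ((lo P / c - l) / W, (hi P / c - l) / W); split => /=.
  + by rewrite ler_pM2r ?invr_gt0 // lerD2r ler_pM2r // invr_gt0.
  + apply: le_trans wid; rewrite le_eqVlt; apply/orP; left; apply/eqP.
    by field; rewrite c0 gt_eqF.
  + move=> k; rewrite /plank_set /= fE => /andP[kl kh].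
    rewrite !ler_pM2r ?invr_gt0 // !lerD2r ler_pdivrMr // ler_pdivlMr //.
    by rewrite ![g k * c]mulrC kl kh.
Qed.

End ConvexBodies.

Unset Implicit Arguments.
Set Strict Implicit.
Set Printing Implicit Defensive.

(** * Covering a convex body by planks *)

Theorem theorem7p1 (R : realType) (n m : nat) (K : set 'rV[R]_n)
    (P : 'I_m -> plank R n) :
  convex_body K ->
  K `<=` \bigcup_(i in [set: 'I_m]) plank_set (P i) ->
  (exists n1 n2 : 'Hom('rV[R]_n, R^o), free [:: n1; n2] /\
     forall i, proportional (normal (P i)) n1 \/
               proportional (normal (P i)) n2) ->
  1 <= \sum_(i < m) width (gauge (difference_body K)) (P i).
Proof.
move=> [compK convK intK] cov [n1 [n2 [n12_free prop]]].
have K0 : K !=set0 by have [z /interior_subset Kz] := intK; exists z.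
have [n1_neq0 n2_neq0] : n1 != 0 /\ n2 != 0.
  move: n12_free; rewrite free_cons seq1_free => /andP[n1n ->]; split => //.
  by apply: contraNneq n1n => ->; exact: mem0v.
have [[L Rt] /= [KL KR] ext1] := linear_form_extrema n1 compK K0.
have [[B T] /= [KB KT] ext2] := linear_form_extrema n2 compK K0.
pose W1 : R := n1 Rt - n1 L; pose W2 : R := n2 T - n2 B.
have osc1 x y : K x -> K y -> n1 x - n1 y <= W1.
  by move=> /ext1/andP[_ x1] /ext1/andP[y0 _]; rewrite /W1; lra.
have osc2 x y : K x -> K y -> n2 x - n2 y <= W2.
  by move=> /ext2/andP[_ x1] /ext2/andP[y0 _]; rewrite /W2; lra.
have W1_gt0 := oscillation_gt0 intK n1_neq0 osc1.
have W2_gt0 := oscillation_gt0 intK n2_neq0 osc2.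
pose X k : R := (n1 k - n1 L) / W1; pose Y k : R := (n2 k - n2 B) / W2.
(* The boolean is true if the normal is a multiple of [n1], which makes the strip
   vertical; the pair holds the bounds of the strip. *)
have strip i : exists st : bool * (R * R), [/\ st.2.1 <= st.2.2,
    st.2.2 - st.2.1 <= width (gauge (difference_body K)) (P i) &
    forall k, plank_set (P i) k ->
      st.2.1 <= (if st.1 then X k else Y k) <= st.2.2].
  have [pr|pr] := prop i.
    have [ab abP] := plank_strip (n1 L) intK W1_gt0 osc1 pr.
    by exists (true, ab).
  have [ab abP] := plank_strip (n2 B) intK W2_gt0 osc2 pr.
  by exists (false, ab).
have [st stP] := choice strip.
have X01 k : K k -> 0 <= X k <= 1.
  move=> /ext1/andP[k0 k1]; rewrite /X ler_pdivlMr // ler_pdivrMr //.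
  by rewrite /W1; apply/andP; split; lra.
have Y01 k : K k -> 0 <= Y k <= 1.
  move=> /ext2/andP[k0 k1]; rewrite /Y ler_pdivlMr // ler_pdivrMr //.
  by rewrite /W2; apply/andP; split; lra.
apply: (@le_trans _ _ (\sum_i ((st i).2.2 - (st i).2.1))); last first.
  by apply: ler_sum => i _; have [] := stP i.
apply: (@quadrilateral_strips R m (fun i => (st i).1) _ _
  (Y L) (Y Rt) (X B) (X T)).
- by move=> i; have [] := stP i.
- exact: Y01.
- exact: Y01.
- exact: X01.
- exact: X01.
move=> a b c d a0 b0 c0 d0 abcd.
have Kk := convex_comb4 convK KL KB KR KT a0 b0 c0 d0 abcd.
have [i _ ik] := cov _ Kk; exists i.
have [_ _ /(_ _ ik)] := stP i.
have lin (f : 'Hom('rV[R]_n, R^o)) :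
    f (a *: L + b *: B + c *: Rt + d *: T) =
    a * f L + b * f B + c * f Rt + d * f T.
  by rewrite !linearD !linearZ.
have bE : b = 1 - a - c - d by lra.
have RtE : n1 Rt = n1 L + W1 by rewrite /W1 addrC subrK.
have TE : n2 T = n2 B + W2 by rewrite /W2 addrC subrK.
have -> : X (a *: L + b *: B + c *: Rt + d *: T) = b * X B + c + d * X T.
  by rewrite /X lin RtE bE; field; rewrite gt_eqF.
have -> // : Y (a *: L + b *: B + c *: Rt + d *: T) = a * Y L + c * Y Rt + d.
by rewrite /Y lin TE bE; field; rewrite gt_eqF.
Qed.
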